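(* Let $1<p\le n$. Then for every $C>0$ there exist a cube $Q\in\mathcal{Q}(\mathbb{R}^n)$, a function $f\in Lip(Q)$ and a function $g\in\mathcal{M}^n_p(Q)$ such that $$\|g(f-f_Q)\|_{L^p(Q)}>C\,\|g\|_{\mathcal{M}^n_p(Q)}\,\|\nabla f\|_{L^p(Q)}.$$
   Context: $\mathcal{Q}(\mathbb{R}^n)$ is the collection of all cubes in $\mathbb{R}^n$ with sides parallel to the coordinate axes. $\mathcal{D}(Q)$ is the collection of all cubes obtained from $Q$ by finitely many (possibly zero) bisections, i.e. the dyadic subcubes of $Q$, including $Q$ itself. $f_Q=\frac{1}{|Q|}\int_Q f(x)\,dx$. $Lip(Q)$ is the family of all Lipschitz continuous functions on $Q$. $L^1_{\rm loc}(Q)$ is the space of functions integrable on every compact subset of $Q$. The Morrey space $\mathcal{M}^n_p(Q)$ (upper index equal to the dimension $n$) is the family of all $g\in L^1_{\rm loc}(Q)$ with $$\|g\|_{\mathcal{M}^n_p(Q)}:=\sup_{R\in\mathcal{D}(Q)}|R|^{\frac1n-\frac1p}\|g\|_{L^p(R)}<\infty.$$ *)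

(* Defs.v *)
From HB Require Import structures.
From mathcomp Require Import all_boot all_order all_algebra.
From mathcomp Require Import all_classical all_reals all_analysis.

Set Implicit Arguments.
Unset Strict Implicit.
Unset Printing Implicit Defensive.
Import Order.TTheory GRing.Theory Num.Theory.
Import numFieldNormedType.Exports.

Local Open Scope classical_set_scope.
Local Open Scope ring_scope.

(* R^n is 'rV[R]_n. Its sigma-algebra is generated by the coordinates, i.e. it
   is the product (= Borel) sigma-algebra, as the library does for n.-tuple. *)
Section rV_measurable.
Context {R : realType} (n : nat).

Definition rV_coord (i : 'I_n) (x : 'rV[R]_n) : R := x 0 i.

Let rV0 : g_sigma_preimage rV_coord set0.
Proof. exact: sigma_algebra0. Qed.

Let rVC A : g_sigma_preimage rV_coord A -> g_sigma_preimage rV_coord (~` A).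
Proof. exact: sigma_algebraC. Qed.

Let rV_bigcup (F : _^nat) : (forall i, g_sigma_preimage rV_coord (F i)) ->
  g_sigma_preimage rV_coord (\bigcup_i (F i)).
Proof. exact: sigma_algebra_bigcup. Qed.

HB.instance Definition _ := @isMeasurable.Build
  (measure_tuple_display default_measure_display)
  'rV[R]_n (g_sigma_preimage rV_coord) rV0 rVC rV_bigcup.

End rV_measurable.

Definition rV_cons (R : realType) (n : nat)
  (xv : measurableTypeR R * 'rV[R]_n) : 'rV[R]_n.+1 := row_mx xv.1%:M xv.2.

(* n-dimensional Lebesgue measure, as an iterated product measure transported
   along R * R^n ~ R^(n+1). *)
Fixpoint lebesgue_rV (R : realType) (n : nat) : set 'rV[R]_n -> \bar R :=
  match n with
  | 0 => \d_(0 : 'rV[R]_0)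
  | m.+1 => pushforward (@lebesgue_measure R \x @lebesgue_rV R m)%E
              (@rV_cons R m)
  end.

Lemma product_sigma_finite d1 d2 (T1 : measurableType d1)
    (T2 : measurableType d2) (R : realType)
    (m1 : {sigma_finite_measure set T1 -> \bar R})
    (m2 : {sigma_finite_measure set T2 -> \bar R}) :
  sigma_finite setT (m1 \x m2)%E.
Proof.
have /sigma_finiteP[F [TF ndF Foo]] := sigma_finiteT m1.
have /sigma_finiteP[G [TG ndG Goo]] := sigma_finiteT m2.
exists (fun n => F n `*` G n).
  rewrite -setXTT TF TG predeqE => -[x y]; split.
    move=> [/= [n _ Fnx] [k _ Gky]]; exists (maxn n k) => //; split.
    - by move: x Fnx; exact/subsetPset/ndF/leq_maxl.
    - by move: y Gky; exact/subsetPset/ndG/leq_maxr.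
  by move=> [n _ []/= ? ?]; split; exists n.
move=> k; have [? ?] := Foo k; have [? ?] := Goo k.
split; first exact: measurableX.
by rewrite product_measure1E// lte_mul_pinfty// ge0_fin_numE.
Qed.

Section lebesgue_rV_measure.
Context {R : realType}.

Lemma measurable_rV_coord (n : nat) (i : 'I_n) :
  measurable_fun [set: 'rV[R]_n] (@rV_coord R n i).
Proof.
move=> _ Y mY; rewrite setTI; apply: sub_sigma_algebra => /=.
rewrite -bigcup_seq/=; exists i => /=; first by rewrite mem_index_enum.
by exists Y => //; rewrite setTI.
Qed.

Lemma measurable_fun_rVP d (T : measurableType d) (n : nat)
    (f : T -> 'rV[R]_n) : measurable_fun [set: T] f <->
  forall i, measurable_fun [set: T] (@rV_coord R n i \o f).
Proof.
split=> [mf i|mf].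
  by apply: measurableT_comp => //; exact: measurable_rV_coord.
apply: (@measurability _ _ _ _ setT f (\big[setU/set0]_(i < n)
  preimage_set_system setT (@rV_coord R n i) measurable)) => // _ [A + <-].
rewrite -bigcup_seq/= => -[i _ [B mB <-]].
by rewrite [X in _ `&` (_ @^-1` X)]setTI; exact: mf.
Qed.

Lemma rV_cons0 (n : nat) xv : rV_coord ord0 (@rV_cons R n xv) = xv.1.
Proof.
rewrite /rV_coord /rV_cons.
by rewrite mxE; case: splitP => //= i _; rewrite !mxE !ord1 mulr1n.
Qed.

Lemma rV_consS (n : nat) xv (i : 'I_n) :
  rV_coord (lift ord0 i) (@rV_cons R n xv) = rV_coord i xv.2.
Proof.
rewrite /rV_coord /rV_cons.
rewrite mxE; case: splitP => [j|j [ij]]; first by rewrite ord1.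
by congr (xv.2 _ _); exact/val_inj.
Qed.

Lemma measurable_rV_cons (n : nat) :
  measurable_fun [set: measurableTypeR R * 'rV[R]_n] (@rV_cons R n).
Proof.
apply/measurable_fun_rVP => i; have [->|] := eqVneq i ord0.
  by rewrite (_ : _ \o _ = fst) //; apply/funext => xv; exact: rV_cons0.
rewrite eq_sym => /unlift_some[j -> _].
rewrite (_ : _ \o _ = @rV_coord R n j \o snd); last first.
  by apply/funext => xv; exact: rV_consS.
by apply: measurableT_comp => //; exact: measurable_rV_coord.
Qed.

Definition rV_uncons (n : nat) (x : 'rV[R]_n.+1)
  : measurableTypeR R * 'rV[R]_n := (x 0 0, \row_i x 0 (lift ord0 i)).

Lemma rV_consK (n : nat) : cancel (@rV_cons R n) (@rV_uncons n).
Proof.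
move=> [x v]; rewrite /rV_uncons; congr pair; first exact: (rV_cons0 (x, v)).
by apply/rowP => i; rewrite mxE; exact: (rV_consS (x, v)).
Qed.

Lemma measurable_rV_uncons (n : nat) :
  measurable_fun [set: 'rV[R]_n.+1] (@rV_uncons n).
Proof.
apply: measurable_fun_pair; first exact: (measurable_rV_coord ord0).
apply/measurable_fun_rVP => i.
rewrite (_ : _ \o _ = @rV_coord R n.+1 (lift ord0 i)).
  exact: measurable_rV_coord.
by apply/funext => x; rewrite /rV_coord /= mxE.
Qed.

Lemma lebesgue_rV_sigma_finite_measure (n : nat) :
  exists mu : {sigma_finite_measure set 'rV[R]_n -> \bar R},
    mu = @lebesgue_rV R n :> (set _ -> _).
Proof.
elim: n => [|n [mu muE]].
  by exists (\d_(0 : 'rV[R]_0) : {sigma_finite_measure set _ -> \bar R}).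
have mc := @measurable_rV_cons n.
pose pf : {measure set 'rV[R]_n.+1 -> \bar R} :=
  pushforward (@lebesgue_measure R \x mu)%E (@rV_cons R n).
pose nu := pf mc.
have nuf : sigma_finite setT nu.
  have [F FT Foo] := product_sigma_finite (@lebesgue_measure R) mu.
  exists (fun k => @rV_uncons n @^-1` F k).
    by rewrite -preimage_bigcup -FT preimage_setT.
  move=> k; have [mF Fk] := Foo k; split.
    by rewrite -[X in measurable X]setTI; exact: measurable_rV_uncons.
  rewrite /= /pushforward -comp_preimage (_ : _ \o _ = id) //.
  by apply/funext => xv; exact: rV_consK.
pose sf := Measure_isSigmaFinite.Build _ _ _ nu nuf.
pose nu' : {sigma_finite_measure set 'rV[R]_n.+1 -> \bar R} :=
  HB.pack (nu : set _ -> _) nu sf.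
by exists nu'; rewrite /= -muE.
Qed.

End lebesgue_rV_measure.

Section lebesgue_rV_instance.
Local Open Scope ereal_scope.
Context {R : realType} (n : nat).
Local Notation mu := (@lebesgue_rV R n).

Let lebesgue_rV0 : mu set0 = 0.
Proof. by have [nu <-] := @lebesgue_rV_sigma_finite_measure R n. Qed.

Let lebesgue_rV_ge0 A : 0 <= mu A.
Proof. by have [nu <-] := @lebesgue_rV_sigma_finite_measure R n. Qed.

Let lebesgue_rV_semi_sigma_additive : semi_sigma_additive mu.
Proof.
have [nu <-] := @lebesgue_rV_sigma_finite_measure R n.
exact: measure_semi_sigma_additive.
Qed.

HB.instance Definition _ := isMeasure.Build _ _ _ mu
  lebesgue_rV0 lebesgue_rV_ge0 lebesgue_rV_semi_sigma_additive.

Let sigma_finite_lebesgue_rV : sigma_finite setT mu.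
Proof.
have [nu <-] := @lebesgue_rV_sigma_finite_measure R n; exact: sigma_finiteT.
Qed.

HB.instance Definition _ := Measure_isSigmaFinite.Build _ _ _ mu
  sigma_finite_lebesgue_rV.

End lebesgue_rV_instance.

Section box.
Context {R : realType}.

Definition box (n : nat) (a b : 'rV[R]_n) : set 'rV[R]_n :=
  [set x | forall i, a 0 i <= x 0 i <= b 0 i].

Lemma measurable_box (n : nat) (a b : 'rV[R]_n) : measurable (box a b).
Proof.
rewrite (_ : box a b = \bigcap_(i in [set: 'I_n])
    (rV_coord i @^-1` `[a 0 i, b 0 i]%classic)); last first.
  apply/seteqP; split => x abx i; first by rewrite /= in_itv; have := abx i.
  by have := abx i Logic.I; rewrite /= in_itv.
apply: fin_bigcap_measurable => // i _; rewrite -[X in measurable X]setTI.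
by apply: measurable_rV_coord => //; exact: measurable_itv.
Qed.

Lemma lebesgue_rV_box (n : nat) (a b : 'rV[R]_n) :
  (forall i, a 0 i <= b 0 i) ->
  lebesgue_rV (box a b) = (\prod_i (b 0 i - a 0 i))%:E.
Proof.
elim: n => [|n IHn] in a b *; move=> ab.
  by rewrite big_ord0 /= diracE mem_set// => -[].
rewrite big_ord_recl /= /pushforward.
pose tl (c : 'rV[R]_n.+1) : 'rV[R]_n := \row_i c 0 (lift ord0 i).
rewrite (_ : _ @^-1` _ = `[a 0 0, b 0 0]%classic `*` box (tl a) (tl b)).
  rewrite product_measure1E//; last exact: measurable_box.
  rewrite /= IHn; last by move=> i; rewrite !mxE.
  rewrite lebesgue_measure_itv/= lte_fin.
  under eq_bigr do rewrite !mxE.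
  case: ltP => [_|ba]; first by rewrite -EFinM.
  by rewrite (_ : b 0 0 = a 0 0) ?subrr ?mul0r ?mul0e//; apply/le_anti/andP.
apply/seteqP; split => [xv /= H|xv /= [H0 H1] i].
  split; first by have := H 0; rewrite in_itv/= [rV_cons _ _ _]rV_cons0.
  move=> i; rewrite !mxE; have := H (lift ord0 i).
  by rewrite [rV_cons _ _ _]rV_consS.
have [->|] := eqVneq i ord0.
  by rewrite [rV_cons _ _ _]rV_cons0; move: H0; rewrite in_itv.
rewrite eq_sym => /unlift_some[j -> _]; rewrite [rV_cons _ _ _]rV_consS.
by have := H1 j; rewrite !mxE.
Qed.

End box.

Section cubes.
Context {R : realType} {n : nat}.

Record cube := Cube {
  corner : 'rV[R]_n;
  side : R;
  side_gt0 : 0 < side }.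

Definition cube_set (Q : cube) : set 'rV[R]_n :=
  box (corner Q) (\row_i (corner Q 0 i + side Q)).

Lemma half_side_gt0 (Q : cube) : 0 < side Q / 2.
Proof. by rewrite divr_gt0// side_gt0. Qed.

(* One of the 2^n cubes obtained by bisecting all sides of Q: e is the set of
   directions in which the upper half is taken. *)
Definition cube_child (Q : cube) (e : {set 'I_n}) : cube :=
  Cube (\row_i (corner Q 0 i + (side Q / 2) *+ (i \in e))) (half_side_gt0 Q).

Inductive dyadic (Q : cube) : cube -> Prop :=
| dyadic_refl : dyadic Q Q
| dyadic_child P e : dyadic Q P -> dyadic Q (cube_child P e).

Lemma lebesgue_rV_cube (Q : cube) :
  lebesgue_rV (cube_set Q) = (side Q ^+ n)%:E.
Proof.
rewrite lebesgue_rV_box => [|i]; last by rewrite mxE lerDl ltW// side_gt0.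
under eq_bigr do rewrite mxE addrAC subrr add0r.
by rewrite prodr_const card_ord.
Qed.

End cubes.
Arguments cube : clear implicits.
Coercion cube_set : cube >-> set.

Section function_spaces.
Context {R : realType} {n : nat}.
Implicit Types (Q : cube R n) (f g : 'rV[R]_n -> R) (p : R).
Local Notation mu := (@lebesgue_rV R n).

(* Functions on Q are total functions of which only the values on Q matter. *)

Definition mean Q f : R := (\int[mu]_(x in Q) f x) / fine (mu Q).

Definition Lp_norm p (A : set 'rV[R]_n) f : \bar R :=
  'N[mu]_(p%:E)[(EFin \o f) \_ A]%E.

Lemma Lp_normE p (A : set 'rV[R]_n) f : 0 < p ->
  Lp_norm p A f = ((\int[mu]_(x in A) (`|f x| `^ p)%:E) `^ p^-1)%E.
Proof.
move=> p0; rewrite /Lp_norm unlock; congr (_ `^ _)%E.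
rewrite [RHS]integral_mkcond; apply: eq_integral => x _.
rewrite /restrict /patch /=; case: ifP => // _.
by rewrite /= normr0 powR0// gt_eqF.
Qed.

(* The norm of 'rV[R]_n is the sup norm; Lipschitz continuity does not depend
   on the choice of the norm. *)
Definition Lip Q f : Prop := [lipschitz f x | x in Q].

Definition gradient f (x : 'rV[R]_n) : 'rV[R]_n :=
  \row_i 'D_(delta_mx 0 i) f x.

Definition euclidean_norm (v : 'rV[R]_n) : R := Num.sqrt (\sum_i v 0 i ^+ 2).

Definition loc_integrable Q g : Prop :=
  forall K : set 'rV[R]_n, compact K -> K `<=` Q ->
    mu.-integrable K (EFin \o g).

Definition morrey_norm p Q g : \bar R :=
  ereal_sup [set (mu P `^ (n%:R^-1 - p^-1) * Lp_norm p P g)%E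
            | P in (dyadic Q : set (cube R n))].

Definition morrey p Q g : Prop :=
  loc_integrable Q g /\ (morrey_norm p Q g < +oo)%E.

(* If f is Lipschitz on Q, then the partial derivatives exist almost everywhere
   in the interior of Q (Rademacher) and are determined there by the values of
   f on Q; the values of gradient f on the remaining null set are irrelevant. *)
Definition gradient_Lp_norm p Q f : \bar R :=
  Lp_norm p Q (fun x => euclidean_norm (gradient f x)).

End function_spaces.

(* Main.v *)
Require Import Defs.
From mathcomp Require Import all_boot all_order all_algebra.
From mathcomp Require Import all_classical all_reals all_analysis.
From mathcomp Require Import measurable_realfun zify ring lra.

Set Implicit Arguments.
Unset Strict Implicit.
Unset Printing Implicit Defensive.
Import Order.TTheory GRing.Theory Num.Theory.
Import numFieldNormedType.Exports.
Local Open Scope classical_set_scope.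
Local Open Scope ring_scope.

(** The trace inequality in the statement would bound the integral of
    |g| ^ p * |f - f_Q| ^ p by the integral of |grad f| ^ p, the energy of f, for
    every measure |g| ^ p dx that gives mass at most l ^ (n - p) to dyadic
    cubes of side l. It fails because this growth condition allows measures
    concentrated near a set E of dimension n - p, and such sets have zero
    p-capacity when p > 1: a function can be as large as N on E with energy of
    order N only.

    A finite stage of a Cantor-like set replaces E. In the unit cube, dyadic
    cells are selected level by level, the number of selected cells of level k
    being comparable to t ^ k with t = 2 ^ (n - p) ([size_cells]), and evenly
    distributed among the cells of the coarser levels ([count_cells]). The
    weight g is 2 ^ N times the p-th root of the counting function of the
    cells of level N. A cell of level k <= N contains at most
    2 ^ n * t ^ (N - k) of these cells, each of volume 2 ^ (- n N), so that |g| ^ p gives it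
    mass at most of order 2 ^ (- k (n - p)), and the Morrey norm of g is
    bounded independently of N ([morrey_norm_weight]). This holds for real p,
    including p = n, when a single cell is selected at each level.

    The function f is the sum over the scales k < N of a bump of height of
    order 1 and slope 2 ^ k around the selected cells of level k
    ([potential]), essentially the logarithm of the inverse distance to E. The
    bump of level k lives on a set of volume of order 2 ^ (- k p). Hence f has
    a mean that is bounded independently of N ([mean_potential]), and every
    scale adds a bounded amount to the integral of |grad f| ^ p, which is thus
    of order N ([gradient_norm_potential]). On the support of g all N bumps
    are at least 1, so the left-hand side is of order N
    ([norm_weight_potential]), while the right-hand side is of order
    N ^ (1 / p). As p > 1, a large N concludes. *)

(** * Selected dyadic cells *)

Section cells.
Context {R : realType} {n : nat}.
Implicit Types (m r : {ffun 'I_n -> nat}) (t : R).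

(** A multi-index stands for the dyadic cell of a given level with that integer
    position; [cell_child] doubles the position and picks a corner, in step
    with [cube_child]. *)
Definition cell_child m (e : {set 'I_n}) : {ffun 'I_n -> nat} :=
  [ffun i => ((m i).*2 + (i \in e))%N].

Definition ancestor j m : {ffun 'I_n -> nat} := [ffun i => (m i %/ 2 ^ j)%N].

Lemma ancestor0 m : ancestor 0 m = m.
Proof. by apply/ffunP => i; rewrite ffunE divn1. Qed.

Lemma ancestor_child j m e : ancestor j.+1 (cell_child m e) = ancestor j m.
Proof.
apply/ffunP => i; rewrite !ffunE expnS divnMA; congr (_ %/ _)%N.
by case: (i \in e); lia.
Qed.

Lemma cell_child_inj m m' e e' :
  cell_child m e = cell_child m' e' -> (m, e) = (m', e').
Proof.
move=> /ffunP mm'; have {}mm' i : m i = m' i /\ (i \in e) = (i \in e').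
  by have := mm' i; rewrite !ffunE; case: (i \in e); case: (i \in e'); lia.
by congr (_, _); [apply/ffunP => i; have [] := mm' i|
                  apply/setP => i; have [] := mm' i].
Qed.

(** The greedy rule makes the number of selected cells follow t ^+ k without
    any arithmetic on t: all children are kept as long as the count does not
    overshoot, and only the lowest one otherwise. *)
Fixpoint cells t k : seq {ffun 'I_n -> nat} :=
  if k is j.+1 then
    [seq cell_child m e | m <- cells t j,
      e <- if (2 ^ n * size (cells t j))%:R <= t ^+ j.+1
           then enum {set 'I_n} else [:: finset.set0]]
  else [:: [ffun=> 0%N]].

Lemma cells_uniq t k : uniq (cells t k).
Proof.
elim: k => //= k IH; apply: allpairs_uniq => //.
  by case: ifP => // _; exact: enum_uniq.
by move=> [m e] [m' e'] _ _ /=; exact: cell_child_inj.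
Qed.

Lemma ancestor_cells t k m : m \in cells t k.+1 -> ancestor 1 m \in cells t k.
Proof.
by move=> /allpairsP[[m' e] [/= m't _ ->]]; rewrite ancestor_child ancestor0.
Qed.

(** The count is multiplied by 1 or 2 ^ n at each level while t ^+ k is
    multiplied by t, which lies in between; the greedy choice keeps the former
    within a factor 2 ^ n below the latter. *)
Lemma size_cells t k : 1 <= t -> t <= 2 ^+ n ->
  (size (cells t k))%:R <= t ^+ k <= 2 ^+ n * (size (cells t k))%:R.
Proof.
move=> t1 t2; have t0 : 0 < t by lra.
elim: k => [|k /andP[IHl IHr]].
  by rewrite expr0 lexx /= mulr1 exprn_ege1// ler1n.
rewrite [cells _ _]/= size_allpairs natrM.
have tk0 : 0 <= t ^+ k by rewrite exprn_ge0// ltW.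
case: ifP => [|/negbT]; rewrite natrM natrX mulrC.
  rewrite -cardE -cardsT -powersetT card_powerset cardsT card_ord natrX => -> /=.
  by rewrite exprS [_%:R * _]mulrC ler_pM// ltW.
rewrite -ltNge mulr1 mulrC => /ltW -> /=; rewrite andbT.
by rewrite (le_trans IHl)// exprS ler_peMl.
Qed.

(** Whether a cell is split depends on its level only, so all the cells of level
    k have equally many descendants of level k + j. The product form avoids
    dividing by the number of cells of level k. *)
Lemma count_cells t k j r :
  (count (fun m => ancestor j m == r) (cells t (k + j)) * size (cells t k)
     <= size (cells t (k + j)))%N.
Proof.
elim: j => [|j IH].
  rewrite addn0 (eq_count (a2 := pred1 r)) => [|m]; last by rewrite ancestor0.
  by rewrite count_uniq_mem ?cells_uniq//; case: (r \in _); lia.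
rewrite addnS /= size_allpairs; set es := (if _ then _ else _).
rewrite (_ : count _ _ = (count (fun m => ancestor j m == r) (cells t (k + j))
    * size es)%N); first by nia.
elim: (cells _ _) => //= m s IHs; rewrite count_cat IHs mulnDl; congr addn.
rewrite count_map (eq_count (a2 := fun=> ancestor j m == r)).
  by case: (_ == r); rewrite ?mul1n ?mul0n ?count_predT ?count_pred0.
by move=> e /=; rewrite ancestor_child.
Qed.

End cells.

(** * Geometry of dyadic cells *)

Section grid.
Context {R : realType} {n : nat}.
Implicit Types (m r : {ffun 'I_n -> nat}) (t : R).
Local Notation mu := (@lebesgue_rV R n).

Definition cell k m : set 'rV[R]_n :=
  box (\row_i ((m i)%:R / 2 ^+ k)) (\row_i ((m i).+1%:R / 2 ^+ k)).

Lemma measurable_cell k m : measurable (cell k m).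
Proof. exact: measurable_box. Qed.

Lemma expr2_gt0 k : 0 < 2 ^+ k :> R. Proof. by rewrite exprn_gt0. Qed.
Hint Resolve expr2_gt0 : core.

Lemma lebesgue_cell k m : mu (cell k m) = ((2 ^+ n) ^- k)%:E.
Proof.
rewrite lebesgue_rV_box => [|i].
  under eq_bigr do rewrite !mxE -mulrBl -natr1 addrAC subrr add0r mul1r.
  by rewrite prodr_const card_ord exprVn -!exprM mulnC.
by rewrite !mxE ler_pM2r ?invr_gt0// ler_nat.
Qed.

Lemma cell_sub_parent k m : cell k.+1 m `<=` cell k (ancestor 1 m).
Proof.
move=> x mx i; have /andP[] := mx i; rewrite !mxE ffunE expn1.
rewrite !exprS !ler_pdivrMr ?ler_pdivlMr ?mulr_gt0// => lo hi.
have lo2 : ((m i %/ 2)%N%:R * 2 : R) <= (m i)%:R by rewrite -natrM ler_nat; lia.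
have hi2 : ((m i).+1%:R : R) <= (m i %/ 2).+1%:R * 2.
  by rewrite -natrM ler_nat; lia.
by apply/andP; split; have := expr2_gt0 k; nra.
Qed.

(** Points of a selected cell of the last level see a selected cell at every
    earlier level; this is what makes the test function large there. *)
Lemma cells_descend t N m x : m \in cells t N -> cell N m x ->
  forall k, (k <= N)%N -> exists2 r, r \in cells t k & cell k r x.
Proof.
elim: N m => [|N IH] m mN mx k; first by rewrite leqn0 => /eqP ->; exists m.
rewrite leq_eqVlt => /predU1P[->|]; first by exists m.
rewrite ltnS; apply: (IH _ (ancestor_cells mN)).
exact: cell_sub_parent.
Qed.

(** The slice is contained in a box that is degenerate in the direction i. *)
Lemma box_slice_null (a b : 'rV[R]_n) i c : (forall j, a 0 j <= b 0 j) ->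
  mu (box a b `&` [set x | x 0 i = c]) = 0%E.
Proof.
move=> ab; pose a' := \row_j (if j == i then c else a 0 j).
pose b' := \row_j (if j == i then c else b 0 j).
have a'b' j : a' 0 j <= b' 0 j by rewrite !mxE; case: ifP.
have sub : box a b `&` [set x | x 0 i = c] `<=` box a' b'.
  move=> x [abx /= xc] j; rewrite !mxE.
  by case: eqP => [->|_]; rewrite ?xc ?lexx ?abx.
apply/eqP; rewrite eq_le measure_ge0 andbT.
suff <- : mu (box a' b') = 0%E.
  apply: le_measure sub; rewrite inE; last exact: measurable_box.
  apply: measurableI; first exact: measurable_box.
  rewrite -[X in measurable X]setTI.
  exact: (measurable_rV_coord i) measurableT [set c] (measurable_set1 c).
by rewrite lebesgue_rV_box// (bigD1 i)//= !mxE eqxx subrr mul0r.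
Qed.

(** Closed dyadic cells that are not nested share at most a piece of a
    hyperplane: in a direction where the ancestor of the finer cell differs from
    the coarser cell, the two intervals have at most an endpoint in common. *)
Lemma cell_overlap_null k j m r : ancestor j m != r ->
  mu (cell (k + j) m `&` cell k r) = 0%E.
Proof.
move=> mr; have [i mri] : exists i, (m i %/ 2 ^ j)%N != r i.
  apply/existsP; apply: contraNT mr; rewrite negb_exists => /forallP H.
  by apply/eqP/ffunP => i; rewrite ffunE; apply/eqP; have := H i; rewrite negbK.
(* The common endpoint is the left or the right end of the coarser interval,
   according to the side on which the finer one lies. *)
pose c : R :=
  (if (m i %/ 2 ^ j < r i)%N then (r i)%:R else (r i).+1%:R) / 2 ^+ k.
have sub : cell (k + j) m `&` cell k r `<=`
           cell (k + j) m `&` [set x | x 0 i = c].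
  move=> x [mx rx]; split => //=; have := mx i; have := rx i; rewrite !mxE.
  have -> : (2 ^+ (k + j) : R) = 2 ^+ k * 2 ^+ j by rewrite exprD.
  rewrite /c !ler_pdivrMr ?ler_pdivlMr ?mulr_gt0//.
  have K := expr2_gt0 k; have J := expr2_gt0 j.
  case: ltnP => [lt|ge] /andP[lo hi] /andP[lo' hi'].
    have : ((m i).+1%:R : R) <= (r i)%:R * 2 ^+ j.
      by rewrite -natrX -natrM ler_nat -ltn_divLR// expn_gt0.
    move=> H; apply: (canRL (mulfK (lt0r_neq0 K))).
    apply/eqP; rewrite eq_le lo andbT.
    by rewrite -(ler_pM2r J) (le_trans _ H)// -mulrA.
  have : ((r i).+1%:R * 2 ^+ j : R) <= (m i)%:R.
    rewrite -natrX -natrM ler_nat -leq_divRL ?expn_gt0//.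
    by rewrite ltn_neqAle eq_sym mri.
  move=> H; apply: (canRL (mulfK (lt0r_neq0 K))).
  apply/eqP; rewrite eq_le hi /=.
  by rewrite -(ler_pM2r J) (le_trans H)// -mulrA.
apply/eqP; rewrite eq_le measure_ge0 andbT.
rewrite (le_trans (le_measure _ _ _ sub))//= ?inE.
- by apply: measurableI; exact: measurable_cell.
- apply: measurableI; first exact: measurable_cell.
  rewrite -[X in measurable X]setTI.
  exact: (measurable_rV_coord i) measurableT [set c] (measurable_set1 c).
by rewrite box_slice_null// => l; rewrite !mxE ler_pM2r ?invr_gt0// ler_nat.
Qed.

End grid.

(** * Integrals of step functions *)

Section unmeasured_integrals.
Context d (T : measurableType d) (R : realType).
Context (mu : {measure set T -> \bar R}).
Implicit Types (D E : set T) (f g : T -> \bar R).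
Local Open Scope ereal_scope.

(** The integral of a nonnegative function is a supremum over the simple
    functions below it, hence is monotone for arbitrary functions. Gradients and
    test functions can thus be compared with step functions without any
    measurability argument. *)
Lemma le_integral_ge0 D f g : (forall x, D x -> 0 <= f x) ->
  (forall x, D x -> f x <= g x) ->
  \int[mu]_(x in D) f x <= \int[mu]_(x in D) g x.
Proof.
move=> f0 fg; have g0 x : D x -> 0 <= g x.
  by move=> Dx; apply: le_trans (f0 _ Dx) (fg _ Dx).
rewrite !ge0_integralE//; apply: le_ereal_sup => _ [h /= hf <-]; exists h => // x.
by apply: le_trans (hf x) _; rewrite /patch; case: ifPn => // /set_mem /fg.
Qed.

Lemma le_integral_subset D E f : (forall x, E x -> 0 <= f x) -> D `<=` E ->
  \int[mu]_(x in D) f x <= \int[mu]_(x in E) f x.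
Proof.
move=> f0 DE; rewrite integral_mkcond [leRHS]integral_mkcond.
apply: le_integral_ge0 => x _; last exact: restrict_lee.
by apply: erestrict_ge0 => y /DE; exact: f0.
Qed.

Lemma integral_sum_indic (I : Type) (s : seq I) (B : I -> set T) D :
  measurable D -> (forall i, measurable (B i)) ->
  \int[mu]_(x in D) (\sum_(i <- s) \1_(B i) x)%:E = \sum_(i <- s) mu (B i `&` D).
Proof.
move=> mD mB; under eq_integral do rewrite -sumEFin.
rewrite ge0_integral_sum//.
- by apply: eq_bigr => i _; rewrite integral_indic.
- by move=> i; apply/measurable_EFinP; exact: measurable_indic.
Qed.

End unmeasured_integrals.

Section mass.
Context {R : realType} {n : nat}.
Implicit Types (m r : {ffun 'I_n -> nat}) (t : R).
Local Notation mu := (@lebesgue_rV R n).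

(** Counting the cells with multiplicity, rather than taking the indicator of
    their union, makes every integral of [mass] a plain sum of volumes, although
    the closed cells share boundaries. *)
Definition mass t N (x : 'rV[R]_n) : R := \sum_(m <- cells t N) \1_(cell N m) x.

Lemma mass_ge0 t N x : 0 <= mass t N x. Proof. exact: sumr_ge0. Qed.

Lemma measurable_mass t N : measurable_fun setT (mass t N).
Proof.
by apply: measurable_sum => m; apply: measurable_indic; exact: measurable_cell.
Qed.

Lemma measurable_EFin_mass t N A :
  measurable_fun A (fun x : 'rV[R]_n => (mass t N x)%:E).
Proof. by apply/measurable_EFinP; apply: measurable_funTS; exact: measurable_mass. Qed.

Lemma lee_sum_count (s : seq {ffun 'I_n -> nat}) (a : pred {ffun 'I_n -> nat})
    (F : {ffun 'I_n -> nat} -> \bar R) (c : R) :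
  (forall m, ~~ a m -> F m = 0%E) -> (forall m, (F m <= c%:E)%E) ->
  (\sum_(m <- s) F m <= (c * (count a s)%:R)%:E)%E.
Proof.
move=> F0 Fc; rewrite (bigID a)/= [X in (_ + X)%E]big1// adde0 -sum1_count natr_sum.
rewrite mulr_sumr -sumEFin; apply: lee_sum => m _.
by rewrite mulr1.
Qed.

(** A cell of level k has at most 2 ^ n * t ^ (N - k) selected descendants of
    level N, and all the other ones meet it in a null set. *)
Lemma integral_mass_coarse t N k r : 1 <= t -> t <= 2 ^+ n -> (k <= N)%N ->
  (\int[mu]_(x in cell k r) (mass t N x)%:E
    <= (2 ^+ n * t ^+ (N - k) * (2 ^+ n) ^- N)%:E)%E.
Proof.
move=> t1 t2 kN; have t0 : 0 < t by lra.
rewrite integral_sum_indic; first last.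
- by move=> m; exact: measurable_cell.
- exact: measurable_cell.
apply: (le_trans (@lee_sum_count _ (fun m => ancestor (N - k) m == r) _
   ((2 ^+ n) ^- N) _ _)) => [m|m|].
- by move=> mr; have := @cell_overlap_null R n k _ _ _ mr; rewrite subnKC.
- rewrite -(lebesgue_cell N m); apply: le_measure; rewrite ?inE; last exact: subIsetl.
  + by apply: measurableI; exact: measurable_cell.
  + exact: measurable_cell.
rewrite lee_fin mulrC ler_wpM2r ?invr_ge0 ?exprn_ge0//.
have := count_cells t k (N - k) r; rewrite subnKC//.
have /andP[_ lo] := size_cells k t1 t2; have /andP[hi _] := size_cells N t1 t2.
set c := count _ _ => cN.
have {}cN : c%:R * (size (@cells R n t k))%:R <= t ^+ N :> R.
  by rewrite (le_trans _ hi)// -natrM ler_nat.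
have tk0 : 0 < t ^+ k by rewrite exprn_gt0.
rewrite -(ler_pM2r tk0) -mulrA -exprD subnK//.
apply: (le_trans (ler_wpM2l (ler0n R c) lo)).
by rewrite mulrCA ler_wpM2l// exprn_ge0.
Qed.

(** Below the last level a cell meets at most one selected cell, namely its own
    ancestor, outside a null set. *)
Lemma integral_mass_fine t N k r : (N <= k)%N ->
  (\int[mu]_(x in cell k r) (mass t N x)%:E <= ((2 ^+ n) ^- k)%:E)%E.
Proof.
move=> Nk.
rewrite integral_sum_indic; first last.
- by move=> m; exact: measurable_cell.
- exact: measurable_cell.
apply: (le_trans (@lee_sum_count _ (pred1 (ancestor (k - N) r)) _
   ((2 ^+ n) ^- k) _ _)) => [m|m|].
- rewrite /= eq_sym => mr; rewrite setIC.
  by have := @cell_overlap_null R n N _ _ _ mr; rewrite subnKC.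
- rewrite -(lebesgue_cell k r); apply: le_measure; rewrite ?inE; last exact: subIsetr.
  + by apply: measurableI; exact: measurable_cell.
  + exact: measurable_cell.
rewrite lee_fin count_uniq_mem ?cells_uniq// ler_piMr ?invr_ge0 ?exprn_ge0//.
by rewrite lern1 leq_b1.
Qed.

Lemma cells_sub_unit t N m : m \in cells t N -> cell N m `<=` @cell R n 0 [ffun=> 0%N].
Proof.
move=> mN x mx; have [r] := cells_descend mN mx (leq0n N).
by rewrite inE => /eqP ->.
Qed.

Lemma integral_mass_unit t N :
  (\int[mu]_(x in cell 0 [ffun=> 0%N]) (mass t N x)%:E =
   ((size (cells (n := n) t N))%:R * (2 ^+ n) ^- N)%:E)%E.
Proof.
rewrite integral_sum_indic; first last.
- by move=> m; exact: measurable_cell.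
- exact: measurable_cell.
rewrite big_seq (eq_bigr (fun=> ((2 ^+ n) ^- N)%:E)) => [|m mN].
  rewrite -big_seq sumEFin big_const_seq count_predT iter_addr_0.
  by rewrite mulr_natl.
by rewrite (setIidl (cells_sub_unit mN)); exact: lebesgue_cell.
Qed.

(** The cube of side 4 / 2 ^ k centred at the lower corner of the cell, outside
    of which the cell does not influence the test function. *)
Definition nbhd_cell k m : set 'rV[R]_n :=
  box (\row_i (((m i)%:R - 2) / 2 ^+ k)) (\row_i (((m i)%:R + 2) / 2 ^+ k)).

Definition cover t k (x : 'rV[R]_n) : R :=
  \sum_(m <- cells t k) \1_(nbhd_cell k m) x.

Lemma cover_ge0 t k x : 0 <= cover t k x. Proof. exact: sumr_ge0. Qed.

Lemma measurable_cover t k : measurable_fun setT (cover t k).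
Proof.
by apply: measurable_sum => m; apply: measurable_indic; exact: measurable_box.
Qed.

Lemma measurable_EFin_cover t k A :
  measurable_fun A (fun x : 'rV[R]_n => (cover t k x)%:E).
Proof. by apply/measurable_EFinP; apply: measurable_funTS; exact: measurable_cover. Qed.

Lemma integral_cover t k (A : set 'rV[R]_n) : 1 <= t -> t <= 2 ^+ n ->
  measurable A ->
  (\int[mu]_(x in A) (cover t k x)%:E <= (4 ^+ n * (t / 2 ^+ n) ^+ k)%:E)%E.
Proof.
move=> t1 t2 mA; rewrite integral_sum_indic//; last first.
  by move=> m; exact: measurable_box.
apply: (le_trans (@lee_sum_count _ predT _ ((4 / 2 ^+ k) ^+ n) _ _)) => // [m|].
  have -> : ((4 / 2 ^+ k) ^+ n)%:E = mu (nbhd_cell k m).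
    rewrite lebesgue_rV_box => [|i].
      rewrite (eq_bigr (fun=> 4 / 2 ^+ k)) ?prodr_const ?card_ord// => i _.
      by rewrite !mxE; ring.
    by rewrite !mxE ler_pM2r ?invr_gt0 ?exprn_gt0//; lra.
  apply: le_measure; rewrite ?inE; last exact: subIsetl.
    by apply: measurableI => //; exact: measurable_box.
  exact: measurable_box.
rewrite lee_fin count_predT !exprMn !exprVn -!exprM mulnC mulrC mulrCA.
have /andP[hi _] := size_cells k t1 t2.
by rewrite ler_wpM2l ?exprn_ge0// ler_wpM2r// invr_ge0 exprn_ge0.
Qed.

End mass.

(** * Directional derivatives of locally Lipschitz functions *)

Section max_norm.
Context {R : realType} {n : nat}.
Implicit Types (x v : 'rV[R]_n) (f : 'rV[R]_n -> R).

Lemma rV_norm_leP x (e : R) : 0 <= e ->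
  reflect (forall i, `|x 0 i| <= e) (`|x| <= e).
Proof.
move=> e0; apply: (iffP idP) => [xe i|xe].
  by apply: le_trans xe; rewrite [leRHS]/Num.Def.normr /= mx_normrE;
     exact: (le_bigmax _ _ (0, i)).
rewrite [leLHS]/Num.Def.normr /= mx_normrE; apply: bigmax_le => // -[i j] _ /=.
by rewrite ord1.
Qed.

(** Differentiability is not assumed: where the difference quotient diverges,
    its limit takes the default value 0. *)
Lemma derive_le_lipschitz f x v (L e : R) : 0 <= L -> 0 < e ->
  (forall y, `|y - x| < e -> `|f y - f x| <= L * `|y - x|) ->
  `|'D_v f x| <= L * `|v|.
Proof.
move=> L0 e0 fL; rewrite /derive; set q := (X in lim (X @ _)).
have [cq|ncq] := pselect (cvg (q @ 0^')); last first.
  by rewrite (dvgP ncq) normr0 mulr_ge0.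
rewrite -lim_norm//; apply: limr_le; first exact: is_cvg_norm.
have d0 : 0 < e / (`|v| + 1) by rewrite divr_gt0// ltr_wpDl.
near=> h.
have h0 : h != 0 by near: h; exact: nbhs_dnbhs_neq.
have hd : `|h| < e / (`|v| + 1) by near: h; exact: dnbhs0_lt.
have hv : `|h *: v + x - x| = `|h| * `|v| by rewrite addrK normrZ.
rewrite /q /= normrZ normfV mulrC ler_pdivrMr ?normr_gt0//.
rewrite (le_trans (fL _ _))// hv; last by rewrite mulrCA mulrC mulrAC.
rewrite (le_lt_trans (y := `|h| * (`|v| + 1)))//; first by rewrite ler_wpM2l// lerDl.
by rewrite -ltr_pdivlMr// ltr_wpDl.
Unshelve. all: by end_near. Qed.

Lemma euclidean_norm_gradient f x (L e : R) : 0 <= L -> 0 < e ->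
  (forall y, `|y - x| < e -> `|f y - f x| <= L * `|y - x|) ->
  euclidean_norm (gradient f x) <= n%:R * L.
Proof.
move=> L0 e0 fL; rewrite /euclidean_norm.
have nL : 0 <= n%:R * L by rewrite mulr_ge0.
rewrite -(ger0_norm nL) -sqrtr_sqr ler_sqrt ?sqr_ge0//.
apply: (@le_trans _ _ (\sum_(i < n) L ^+ 2)).
  apply: ler_sum => i _; rewrite mxE -[leLHS]real_normK ?num_real// lerXn2r ?nnegrE//.
  rewrite (le_trans (derive_le_lipschitz _ L0 e0 fL))// ler_piMr//.
  by apply/rV_norm_leP => // j; rewrite mxE normr_nat lern1 leq_b1.
rewrite sumr_const card_ord exprMn -[leLHS]mulr_natl ler_wpM2r ?sqr_ge0//.
by rewrite -natrX ler_nat; nia.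
Qed.

End max_norm.

(** * The logarithmic test function *)

Section log_potential.
Context {R : realType} {n : nat}.
Implicit Types (m r : {ffun 'I_n -> nat}) (t : R) (x y : 'rV[R]_n).
Hint Resolve expr2_gt0 : core.

Definition site k m : 'rV[R]_n := \row_i ((m i)%:R / 2 ^+ k).

(** At scale 2 ^- k: at least 1 on the selected cells, negative at distance more
    than 2 * 2 ^- k from their corners. The default -1 keeps the maximum from
    being cut off at 0, so that a negative value remains negative nearby. *)
Definition proximity t k x : R :=
  \big[Num.max/-1]_(m <- cells t k) (2 - 2 ^+ k * `|x - site k m|).

(** A truncated logarithm of the inverse distance to the selected cells: every
    scale at which a point is close to them contributes a term of order 1. *)
Definition potential t N x : R := \sum_(k < N) Num.max 0 (proximity t k x).

Lemma proximity_le2 t k x : proximity t k x <= 2.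
Proof. by apply: bigmax_le => [|m _]; [lra|rewrite gerBl mulr_ge0// ltW]. Qed.

Lemma proximity_lipschitz t k x y :
  `|proximity t k y - proximity t k x| <= 2 ^+ k * `|y - x|.
Proof.
suff H u v : proximity t k u <= proximity t k v + 2 ^+ k * `|u - v|.
  rewrite ler_distlC; have := H y x; have := H x y.
  by rewrite [`|x - y|]distrC; lra.
rewrite /proximity big_seq; apply: bigmax_le => [|m mk].
  have := bigmax_ge_id (cells t k) (-1) predT
    (fun m => 2 - 2 ^+ k * `|v - site k m|).
  by have : 0 <= 2 ^+ k * `|u - v| by []; lra.
have := le_bigmax_seq (-1) m predT
  (fun m => 2 - 2 ^+ k * `|v - site k m|) mk isT.
have := ler_wpM2l (ltW (expr2_gt0 k)) (ler_distD u v (site k m)).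
by rewrite mulrDr [`|v - u|]distrC; lra.
Qed.

Lemma cover_ge1 t k x : 0 <= proximity t k x -> 1 <= cover t k x.
Proof.
move=> px; have [m mk mx] : exists2 m, m \in cells t k & nbhd_cell k m x.
  apply: contrapT => H; move: px; apply/negP; rewrite -ltNge /proximity big_seq.
  apply: bigmax_lt => [|m mk]; first by lra.
  rewrite ltNge; apply/negP => px; apply: H; exists m => // i.
  have : `|x - site k m| <= 2 / 2 ^+ k by rewrite ler_pdivlMr// mulrC; lra.
  move/rV_norm_leP => /(_ (divr_ge0 (ler0n _ _) (ltW (expr2_gt0 k))) i).
  by rewrite !mxE ler_distl -mulrBl -mulrDl.
rewrite /cover (perm_big _ (perm_to_rem mk)) big_cons indicE mem_set//= lerDl.
exact: sumr_ge0.
Qed.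

Lemma proximity_cell t k m x : m \in cells t k -> cell k m x ->
  1 <= proximity t k x.
Proof.
move=> mk mx.
apply: le_trans (le_bigmax_seq (-1) m predT
  (fun m => 2 - 2 ^+ k * `|x - site k m|) mk isT).
suff : 2 ^+ k * `|x - site k m| <= 1 by lra.
rewrite mulrC -ler_pdivlMr// div1r; apply/rV_norm_leP => [|i].
  by rewrite invr_ge0 ltW.
have := mx i; rewrite !mxE -[(m i).+1%:R]natr1 mulrDl mul1r => /andP[lo hi].
by rewrite ger0_norm; lra.
Qed.

Lemma potential_ge t N m x : m \in cells t N -> cell N m x ->
  N%:R <= potential t N x.
Proof.
move=> mN mx; rewrite -[N in leLHS]card_ord -sum1_card natr_sum.
apply: ler_sum => k _; rewrite le_max.
have [r rk rx] := cells_descend mN mx (ltnW (ltn_ord k)).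
by rewrite (proximity_cell rk rx) orbT.
Qed.

Lemma potential_ge0 t N x : 0 <= potential t N x.
Proof. by apply: sumr_ge0 => k _; rewrite le_max lexx. Qed.

Lemma potential_le_cover t N x : potential t N x <= \sum_(k < N) 2 * cover t k x.
Proof.
apply: ler_sum => k _; rewrite ge_max mulr_ge0 ?cover_ge0//=.
case: (leP 0 (proximity t k x)) => [/cover_ge1 c1|p0]; last first.
  by rewrite (le_trans (ltW p0))// mulr_ge0// cover_ge0.
by rewrite (le_trans (proximity_le2 _ _ _))// ler_peMr.
Qed.

(** A local Lipschitz constant of [potential]: only the scales whose bump does not
    vanish near x count. *)
Definition slope t N x : R :=
  \sum_(k < N | 0 <= proximity t k x) 2 ^+ k.

(** A scale where x has negative proximity is switched off in a neighbourhood
    of x, so it adds nothing to the local Lipschitz constant. *)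
Lemma potential_locally_lipschitz t N x : exists2 e : R, 0 < e &
  forall y, `|y - x| < e ->
    `|potential t N y - potential t N x| <= slope t N x * `|y - x|.
Proof.
elim: N => [|N [e e0 IH]].
  by exists 1 => // y _; rewrite /potential /slope !big_ord0 subrr normr0 mul0r.
have split y : potential t N.+1 y = potential t N y + Num.max 0 (proximity t N y).
  by rewrite /potential big_ord_recr.
have pN y : `|Num.max 0 (proximity t N y) - Num.max 0 (proximity t N x)|
    <= 2 ^+ N * `|y - x|.
  have := proximity_lipschitz t N x y; rewrite !ler_distl !maxEle.
  have : 0 <= 2 ^+ N * `|y - x| by rewrite mulr_ge0 // ltW.
  by case: ifP => a; case: ifP => b; lra.
rewrite /slope big_mkcond big_ord_recr -big_mkcond/= -/(slope t N x).
case: ifPn => [px|]; last rewrite -ltNge => px.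
  exists e => // y /IH {}IH; rewrite !split.
  have -> a b c d : (a + b) - (c + d) = (a - c) + (b - d) :> R by ring.
  by rewrite (le_trans (ler_normD _ _))// mulrDl lerD.
exists (Num.min e (- proximity t N x / 2 ^+ N)).
  by rewrite lt_min e0 divr_gt0// oppr_gt0.
move=> y; rewrite lt_min => /andP[/IH {}IH ye].
have py : proximity t N y < 0.
  move: ye; rewrite ltr_pdivlMr// mulrC.
  by have := proximity_lipschitz t N x y; rewrite ler_distl; lra.
by rewrite !split !max_l ?(ltW px) ?(ltW py)// !addr0.
Qed.

Lemma potential_lipschitz t N x y :
  `|potential t N y - potential t N x| <= (\sum_(k < N) 2 ^+ k) * `|y - x|.
Proof.
rewrite /potential -sumrB mulr_suml (le_trans (ler_norm_sum _ _ _))//.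
apply: ler_sum => k _; have := proximity_lipschitz t k x y.
rewrite !ler_distl !maxEle.
have : 0 <= 2 ^+ k * `|y - x| by rewrite mulr_ge0 // ltW.
by case: ifP => a; case: ifP => b; lra.
Qed.

Lemma slope_ge0 t N x : 0 <= slope t N x.
Proof. by apply: sumr_ge0 => k _; rewrite ltW. Qed.

(** The slopes grow geometrically, so the sum is dominated by its last term and
    its p-th power by the sum of the p-th powers. *)
Lemma powR_slope t N x p : 0 < p ->
  slope t N x `^ p <= 2 `^ p * \sum_(k < N) (2 `^ p) ^+ k * cover t k x.
Proof.
move=> p0; elim: N => [|N IH].
  by rewrite /slope !big_ord0 mulr0 powR0// gt_eqF.
have c0 k : 0 <= (2 `^ p) ^+ k * cover t k x.
  by rewrite mulr_ge0 ?cover_ge0// exprn_ge0// powR_ge0.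
rewrite {1}/slope big_mkcond big_ord_recr -big_mkcond/= -/(slope t N x).
rewrite big_ord_recr/= mulrDr; case: ifP => [px|_]; last first.
  by rewrite addr0 (le_trans IH)// lerDl mulr_ge0// ?powR_ge0.
apply: (@le_trans _ _ ((2 * 2 ^+ N) `^ p)).
  have N0 := ltW (expr2_gt0 N); apply: ge0_ler_powR.
  - exact: ltW.
  - by rewrite nnegrE addr_ge0 ?slope_ge0.
  - by rewrite nnegrE mulr_ge0.
  have -> : 2 * 2 ^+ N = 2 ^+ N + 2 ^+ N :> R by ring.
  rewrite lerD2r.
  apply: (@le_trans _ _ (\sum_(k < N) 2 ^+ k)).
    rewrite /slope big_mkcond; apply: ler_sum => k _.
    by case: ifP => // _; rewrite ltW.
  rewrite -subr_ge0; suff -> : \sum_(k < N) 2 ^+ k = 2 ^+ N - 1 :> R by lra.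
  elim: N {IH px N0} => [|N IH]; first by rewrite big_ord0 expr0 subrr.
  by rewrite big_ord_recr/= IH exprS; ring.
rewrite powRM ?(ltW (expr2_gt0 N))// -powR_mulrn// -powRrM [_ * p]mulrC powRrM powR_mulrn ?powR_ge0//.
rewrite -mulrDr ler_wpM2l ?powR_ge0// (le_trans (y := (2 `^ p) ^+ N * cover t N x))//.
  by rewrite ler_peMr ?exprn_ge0 ?powR_ge0// cover_ge1.
by rewrite lerDr sumr_ge0.
Qed.

End log_potential.

(** * Norms of the test function and of the weight *)

Section unit_cube.
Context {R : realType} {n : nat}.

Definition unit_cube : cube R n := Cube 0 ltr01.

Lemma dyadic_unit_cube (P : cube R n) : dyadic unit_cube P ->
  exists k r, P = cell k r :> set _.
Proof.
move=> dP; suff [k [r [cP sP]]] :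
    exists k r, corner P = site k r /\ side P = (2 ^+ k)^-1.
  exists k, r; rewrite /cube_set cP sP; congr (box _ _).
  by apply/rowP => i; rewrite !mxE -[(r i).+1%:R]natr1 mulrDl div1r.
elim: dP => [|P' e _ [k [r [cP sP]]]].
  exists 0%N, [ffun=> 0%N]; rewrite expr0 invr1; split => //.
  by apply/rowP => i; rewrite !mxE ffunE mul0r.
exists k.+1, (cell_child r e).
have k1 : (2 ^+ k.+1)^-1 = (2 ^+ k)^-1 / 2 :> R by rewrite exprS invfM mulrC.
split; rewrite /cube_child /= sP ?k1//; apply/rowP => i; rewrite !mxE cP !mxE ffunE.
by rewrite k1 natrD -mul2n natrM -[X in _ + X]mulr_natl; field; rewrite expf_neq0.
Qed.

Lemma unit_cubeE : unit_cube = cell 0 [ffun=> 0%N] :> set 'rV[R]_n.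
Proof.
rewrite /cube_set /cell; congr (box _ _); apply/rowP => i;
by rewrite !mxE ffunE expr0 divr1 ?add0r.
Qed.

End unit_cube.

Section counterexample.
Context {R : realType} {n : nat} (p : R).
Local Notation mu := (@lebesgue_rV R n).
Local Notation W := (2 ^+ n : R).
Hint Resolve expr2_gt0 : core.

(** The growth rate of the number of cells that produces a set of dimension
    n - p. *)
Definition branching : R := 2 `^ (n%:R - p).
Local Notation t := branching.

(** The p-th root makes the p-th power of [weight] a multiple of [mass]. *)
Definition weight N (x : 'rV[R]_n) : R := 2 ^+ N * mass t N x `^ p^-1.

Lemma branching_gt0 : 0 < t. Proof. by rewrite powR_gt0. Qed.

Lemma branching_ge1 : p <= n%:R -> 1 <= t.
Proof. by move=> pn; rewrite -[1](@powRr0 R 2) ler_powR// ?subr_ge0//; lra. Qed.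

Lemma branching_le : 0 <= p -> t <= W.
Proof.
by move=> p0; rewrite -powR_mulrn// ler_powR//; lra.
Qed.

Lemma branchingM : t * 2 `^ p = W.
Proof. by rewrite -powRD ?subrK ?powR_mulrn//; apply/implyP => _; rewrite pnatr_eq0. Qed.

Lemma weight_ge0 N x : 0 <= weight N x.
Proof. by rewrite mulr_ge0 ?powR_ge0// ltW. Qed.

Lemma weight_powR N x : 0 < p -> weight N x `^ p = (2 `^ p) ^+ N * mass t N x.
Proof.
move=> p0; rewrite /weight powRM ?(ltW (expr2_gt0 N)) ?powR_ge0//.
rewrite -powRrM mulVf ?gt_eqF// powRr1 ?mass_ge0//.
by rewrite -powR_mulrn// -powRrM [_ * p]mulrC powRrM powR_mulrn ?powR_ge0.
Qed.

Lemma measurable_weight N : measurable_fun setT (weight N).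
Proof.
apply: measurable_funM => //.
by apply: (measurableT_comp (measurable_powR _)); exact: measurable_mass.
Qed.

(** The growth condition of order n - p on dyadic cells of side 2 ^- k. Down to
    the last level it comes from the number of selected cells; below it, the
    constant density (2 ^ p) ^ N is at most (2 ^ p) ^ k. *)
Lemma integral_weight N k r : 1 < p -> p <= n%:R ->
  (\int[mu]_(x in cell k r) (weight N x `^ p)%:E <= (W / t ^+ k)%:E)%E.
Proof.
move=> p1 pn; have p0 : 0 < p by lra.
have t1 := branching_ge1 pn; have t2 := branching_le (ltW p0).
have t0 := branching_gt0; have W0 := expr2_gt0 (R := R) n.
have th0 : 0 <= (2 `^ p) ^+ N :> R by rewrite exprn_ge0 ?powR_ge0.
under eq_integral do rewrite weight_powR// EFinM.
rewrite ge0_integralZl_EFin//; first last.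
- exact: measurable_EFin_mass.
- by move=> x _; rewrite lee_fin mass_ge0.
- exact: measurable_cell.
have thE : 2 `^ p = W / t by rewrite -branchingM mulrAC mulfV ?mul1r// gt_eqF.
case: (leqP k N) => kN.
  apply: (le_trans (lee_wpmul2l _ (integral_mass_coarse r t1 t2 kN))).
    by rewrite lee_fin.
  rewrite -EFinM lee_fin thE le_eqVlt; apply/orP; left; apply/eqP.
  rewrite -{1 3}(subnKC kN) expr_div_n !exprD; field.
  by rewrite !expf_neq0 ?gt_eqF.
apply: (le_trans (lee_wpmul2l _ (integral_mass_fine t r (ltnW kN)))).
  by rewrite lee_fin.
rewrite -EFinM lee_fin thE.
apply: (@le_trans _ _ ((W / t) ^+ k * W ^- k)).
  rewrite ler_wpM2r ?invr_ge0 ?exprn_ge0 ?(ltW W0)//.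
  by rewrite ler_weXn2l ?ler_pdivlMr ?mul1r// ltnW.
rewrite expr_div_n mulrAC mulfV ?expf_neq0 ?gt_eqF// ler_pM2r ?invr_gt0 ?exprn_gt0//.
by rewrite exprn_ege1// ler1n.
Qed.

Lemma morrey_norm_weight N : 1 < p -> p <= n%:R ->
  (morrey_norm p (@unit_cube R n) (weight N) <= W%:E)%E.
Proof.
move=> p1 pn; have p0 : 0 < p by lra.
have n0 : (n%:R : R) != 0 by rewrite gt_eqF//; lra.
apply: ge_ereal_sup => _ [P /dyadic_unit_cube [k [r Pkr]] <-].
rewrite Lp_normE// {}Pkr lebesgue_cell poweR_EFin.
have W2 : W = 2 `^ n%:R by rewrite powR_mulrn.
have Wk : W ^- k = 2 `^ (- (n%:R * k%:R)).
  by rewrite powRN powRrM powR_mulrn ?powR_ge0// W2.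
have Wt : W / t ^+ k = 2 `^ (n%:R - (n%:R - p) * k%:R).
  rewrite powRD ?powRN; last by apply/implyP => _; lra.
  by rewrite powRrM !powR_mulrn ?powR_ge0.
have I : ((\int[mu]_(x in cell k r) (`|weight N x| `^ p)%:E) `^ p^-1 <=
          ((W / t ^+ k) `^ p^-1)%:E)%E.
  rewrite -poweR_EFin; apply: gt0_ler_poweR; rewrite ?invr_ge0 ?(ltW p0)//.
  - rewrite in_itv/= leey andbT; apply: integral_ge0 => x _.
    by rewrite lee_fin powR_ge0.
  - rewrite in_itv/= leey andbT lee_fin divr_ge0 ?exprn_ge0// ltW//.
    exact: branching_gt0.
  under eq_integral do rewrite ger0_norm ?weight_ge0//.
  exact: integral_weight.
apply: (le_trans (lee_wpmul2l _ I)); first by rewrite lee_fin powR_ge0.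
rewrite -EFinM lee_fin Wk Wt -!powRrM -powRD; last by apply/implyP => _; lra.
rewrite W2 ler_powR//; first by lra.
rewrite (_ : _ + _ = n%:R / p); last by field; rewrite n0 gt_eqF.
by rewrite ler_pdivrMr// ler_peMr// ltW.
Qed.

Lemma morrey_weight N : 1 < p -> p <= n%:R ->
  morrey p (@unit_cube R n) (weight N).
Proof.
move=> p1 pn; have p0 : 0 < p by lra.
split; last by rewrite (le_lt_trans (morrey_norm_weight N p1 pn))// ltry.
move=> K _ KQ; apply/integrableP; split.
  by apply/measurable_EFinP; apply: measurable_funTS; exact: measurable_weight.
pose B := 2 ^+ N * (size (cells (n := n) t N))%:R `^ p^-1.
apply: (@le_lt_trans _ _ (\int[mu]_(x in @unit_cube R n) B%:E)%E).
  apply: (le_trans (le_integral_subset _ _ KQ)) => [x _//|].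
  apply: le_integral_ge0 => // x _; rewrite abse_EFin lee_fin ger0_norm ?weight_ge0//.
  rewrite ler_wpM2l ?(ltW (expr2_gt0 N))// ge0_ler_powR ?invr_ge0 ?(ltW p0)//.
  - by rewrite nnegrE mass_ge0.
  - by rewrite nnegrE.
  rewrite -sum1_size natr_sum /mass; apply: ler_sum => m _.
  by rewrite indicE lern1 leq_b1.
rewrite integral_cst; last exact: measurable_box.
by rewrite [X in (_ * X)%E](lebesgue_rV_cube (@unit_cube R n)) -EFinM ltry.
Qed.

Lemma Lip_potential N : Lip (@unit_cube R n) (potential t N).
Proof.
rewrite /Lip /lipschitz_on; near=> M; move=> [x y] _ /=.
by rewrite (le_trans (potential_lipschitz _ _ _ _))// ler_wpM2r.
Unshelve. all: by end_near. Qed.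

(** The neighbourhoods of the cells of level k have total volume at most of
    order (2 ^ p) ^- k, which is summable: [potential] has bounded mean although it
    has N terms. *)
Lemma mean_potential N : 1 < p -> p <= n%:R ->
  mean (@unit_cube R n) (potential t N) <= 4 * 4 ^+ n.
Proof.
move=> p1 pn; have p0 : 0 < p by lra.
have t1 := branching_ge1 pn; have t2 := branching_le (ltW p0).
have mQ : measurable (@unit_cube R n : set _) by exact: measurable_box.
rewrite /mean lebesgue_rV_cube expr1n divr1 /Rintegral.
have I : (\int[mu]_(x in @unit_cube R n) (potential t N x)%:E <= (4 * 4 ^+ n)%:E)%E.
  apply: (@le_trans _ _ (\int[mu]_(x in @unit_cube R n)
      (\sum_(k < N) 2%:E * (cover t k x)%:E))%E).
    apply: le_integral_ge0 => x _; first by rewrite lee_fin potential_ge0.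
    under eq_bigr do rewrite -EFinM.
    by rewrite sumEFin lee_fin potential_le_cover.
  have mc (k : nat) : measurable_fun (@unit_cube R n) (fun x => (cover t k x)%:E).
    exact: measurable_EFin_cover.
  rewrite ge0_integral_sum//; first last.
  - by move=> k x _; rewrite -EFinM lee_fin mulr_ge0// cover_ge0.
  - by move=> k; apply: measurable_funeM; exact: mc.
  apply: (@le_trans _ _ (\sum_(k < N) (2 * (4 ^+ n * 2^-1 ^+ k))%:E)%E).
    apply: lee_sum => k _; rewrite ge0_integralZl_EFin//; last first.
      by move=> x _; rewrite lee_fin cover_ge0.
    rewrite EFinM lee_wpmul2l ?lee_fin//.
    apply: (le_trans (integral_cover _ t1 t2 mQ)).
    rewrite lee_fin ler_wpM2l ?exprn_ge0// lerXn2r ?nnegrE ?divr_ge0 ?invr_ge0//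
      ?(ltW (expr2_gt0 n))// ?(ltW branching_gt0)//.
    rewrite ler_pdivrMr// -branchingM mulrA mulrC mulrA ler_peMl//
      ?(ltW branching_gt0)//.
    rewrite ler_pdivlMr// mul1r -[leLHS](@powRr1 R)// ler_powR//; lra.
  rewrite sumEFin lee_fin -!mulr_sumr mulrA [2 * _]mulrC -mulrA [leRHS]mulrC.
  rewrite ler_wpM2l ?exprn_ge0//.
  suff -> : \sum_(k < N) 2^-1 ^+ k = 2 - 2 * 2^-1 ^+ N :> R.
    have : 0 <= 2^-1 ^+ N :> R by rewrite exprn_ge0 ?invr_ge0.
    by lra.
  elim: N => [|N IH]; first by rewrite big_ord0 expr0 mulr1 subrr.
  by rewrite big_ord_recr/= IH exprS; field.
have : (0 <= \int[mu]_(x in @unit_cube R n) (potential t N x)%:E)%E.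
  by apply: integral_ge0 => x _; rewrite lee_fin potential_ge0.
by case: (integral _ _ _) I => [r||]//=; rewrite lee_fin.
Qed.

(** Every scale contributes a bounded amount to the energy, since the slope
    factor (2 ^ p) ^ k cancels the volume (2 ^ p) ^- k; this gives
    N ^ (1 / p). *)
Lemma gradient_norm_potential N : 1 < p -> p <= n%:R ->
  (gradient_Lp_norm p (@unit_cube R n) (potential t N)
    <= (2 * n%:R * 4 ^+ n * N%:R `^ p^-1)%:E)%E.
Proof.
move=> p1 pn; have p0 : 0 < p by lra.
have t1 := branching_ge1 pn; have t2 := branching_le (ltW p0).
have mQ : measurable (@unit_cube R n : set _) by exact: measurable_box.
have th0 : 0 < 2 `^ p :> R by rewrite powR_gt0.
pose A : R := (2 * n%:R) `^ p.
have A0 : 0 <= A by exact: powR_ge0.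
have mc (k : nat) : measurable_fun (@unit_cube R n) (fun x => (cover t k x)%:E).
  exact: measurable_EFin_cover.
have I : (\int[mu]_(x in @unit_cube R n)
    (`|euclidean_norm (gradient (potential t N) x)| `^ p)%:E <= (A * 4 ^+ n * N%:R)%:E)%E.
  apply: (@le_trans _ _ (\int[mu]_(x in @unit_cube R n)
      (\sum_(k < N) (A * (2 `^ p) ^+ k)%:E * (cover t k x)%:E))%E).
    apply: le_integral_ge0 => x _; first by rewrite lee_fin powR_ge0.
    under eq_bigr do rewrite -EFinM -mulrA.
    rewrite sumEFin lee_fin -mulr_sumr /A [2 * _]mulrC powRM// -mulrA.
    have [e e0 He] := potential_locally_lipschitz t N x.
    have G := euclidean_norm_gradient (slope_ge0 t N x) e0 He.
    apply: (@le_trans _ _ ((n%:R * slope t N x) `^ p)).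
      rewrite ge0_ler_powR ?(ltW p0) ?nnegrE ?mulr_ge0 ?slope_ge0//.
      by rewrite ger0_norm// sqrtr_ge0.
    by rewrite powRM ?slope_ge0// ler_wpM2l ?powR_ge0// powR_slope.
  rewrite ge0_integral_sum//; first last.
  - by move=> k x _; rewrite -EFinM lee_fin !mulr_ge0// ?cover_ge0// exprn_ge0// ltW.
  - by move=> k; apply: measurable_funeM; exact: mc.
  apply: (@le_trans _ _ (\sum_(k < N) (A * 4 ^+ n)%:E)%E); last first.
    by rewrite sumEFin sumr_const card_ord mulr_natr.
  apply: lee_sum => k _.
  have thk : 0 <= A * (2 `^ p) ^+ k by rewrite mulr_ge0// exprn_ge0// ltW.
  rewrite ge0_integralZl_EFin//; last by move=> x _; rewrite lee_fin cover_ge0.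
  apply: (le_trans (lee_wpmul2l _ (integral_cover k t1 t2 mQ))).
    by rewrite lee_fin.
  rewrite -EFinM lee_fin -mulrA ler_wpM2l// mulrCA -exprMn mulrA [_ * t]mulrC.
  by rewrite branchingM divff ?gt_eqF// expr1n mulr1.
rewrite /gradient_Lp_norm Lp_normE//.
apply: (@le_trans _ _ ((A * 4 ^+ n * N%:R)%:E `^ p^-1)%E).
  apply: gt0_ler_poweR I; rewrite ?invr_ge0 ?(ltW p0)//.
  - rewrite in_itv/= leey andbT; apply: integral_ge0 => x _.
    by rewrite lee_fin powR_ge0.
  - by rewrite in_itv/= leey andbT lee_fin !mulr_ge0// exprn_ge0.
rewrite poweR_EFin lee_fin !powRM ?mulr_ge0 ?exprn_ge0//.
rewrite /A -powRrM mulfV ?gt_eqF// powRr1 ?mulr_ge0//.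
rewrite ler_wpM2r ?powR_ge0// ler_wpM2l ?mulr_ge0//.
rewrite -[leRHS]powRr1 ?exprn_ge0// ler_powR ?exprn_ege1//; first by lra.
by rewrite invf_le1// ltW.
Qed.

(** Where [weight] does not vanish, [potential] is at least N, while its mean is
    at most half of that once N is large; and the total of [weight] ^ p is at
    least 2 ^- n. *)
Lemma norm_weight_potential N : 1 < p -> p <= n%:R -> 8 * 4 ^+ n <= N%:R :> R ->
  ((N%:R / (2 * W))%:E <=
    Lp_norm p (@unit_cube R n) (fun x =>
      (weight N x * (potential t N x - mean (@unit_cube R n) (potential t N)))%R))%E.
Proof.
move=> p1 pn NM; have p0 : 0 < p by lra.
have t1 := branching_ge1 pn; have t2 := branching_le (ltW p0).
have t0 := branching_gt0; have W0 := expr2_gt0 (R := R) n.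
have mQ : measurable (@unit_cube R n : set _) by exact: measurable_box.
have th0 : 0 < 2 `^ p :> R by rewrite powR_gt0.
have N2 : 0 <= N%:R / 2 :> R by rewrite divr_ge0.
rewrite Lp_normE//.
have I : (((N%:R / 2) `^ p / W)%:E <= \int[mu]_(x in @unit_cube R n)
    (`|weight N x * (potential t N x - mean (@unit_cube R n) (potential t N))| `^ p)%:E)%E.
  pose c := (N%:R / 2) `^ p * (2 `^ p) ^+ N.
  have c0 : 0 <= c by rewrite mulr_ge0 ?powR_ge0// exprn_ge0// ltW.
  apply: (@le_trans _ _ (\int[mu]_(x in @unit_cube R n) (c%:E * (mass t N x)%:E))%E).
    rewrite ge0_integralZl_EFin//; first last.
    - exact: measurable_EFin_mass.
    - by move=> x _; rewrite lee_fin mass_ge0.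
    rewrite unit_cubeE integral_mass_unit -EFinM lee_fin /c -mulrA.
    rewrite ler_wpM2l ?powR_ge0//.
    have /andP[_ lo] := size_cells N t1 t2.
    have tN0 : 0 < t ^+ N by rewrite exprn_gt0.
    have -> : 2 `^ p = W / t by rewrite -branchingM mulrAC mulfV ?mul1r// gt_eqF.
    rewrite expr_div_n [leRHS](_ : _ = (size (cells (n := n) t N))%:R / t ^+ N).
      by rewrite ler_pdivlMr// mulrC ler_pdivrMr// mulrC.
    by field; rewrite !gt_eqF// exprn_gt0.
  apply: le_integral_ge0 => x _; first by rewrite -EFinM lee_fin mulr_ge0 ?mass_ge0.
  rewrite -EFinM lee_fin.
  have [->|m0] := eqVneq (mass t N x) 0; first by rewrite mulr0 powR_ge0.
  have [m mN mx] : exists2 m, m \in cells t N & cell N m x.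
    apply: contrapT => H; move/eqP: m0; apply.
    rewrite /mass big_seq big1// => m mN; rewrite indicE memNset// => mx.
    by apply: H; exists m.
  have fN := potential_ge mN mx.
  have fM := mean_potential N p1 pn.
  rewrite normrM powRM// [`|weight N x|]ger0_norm ?weight_ge0// weight_powR//.
  rewrite /c -[leLHS]mulrA [leLHS]mulrC ler_wpM2l ?mulr_ge0 ?mass_ge0 ?exprn_ge0 ?(ltW th0)//.
  rewrite ge0_ler_powR ?(ltW p0)//.
  by rewrite (le_trans _ (ler_norm _))//; lra.
apply: (@le_trans _ _ (((N%:R / 2) `^ p / W)%:E `^ p^-1)%E); last first.
  apply: gt0_ler_poweR I; rewrite ?invr_ge0 ?(ltW p0)//.
  - by rewrite in_itv/= leey andbT lee_fin divr_ge0 ?powR_ge0// ltW.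
  - rewrite in_itv/= leey andbT; apply: integral_ge0 => x _.
    by rewrite lee_fin powR_ge0.
rewrite poweR_EFin lee_fin powRM ?powR_ge0 ?invr_ge0 ?(ltW W0)//.
rewrite -powRrM mulfV ?gt_eqF// powRr1//.
rewrite invfM mulrA ler_wpM2l//.
rewrite -[W^-1]powR_inv1 ?(ltW W0)// -powRrM ler_powR//.
  by rewrite exprn_ege1// ler1n.
by rewrite mulN1r lerN2 invf_le1// ltW.
Qed.

End counterexample.

(** * Failure of the inequality *)

Theorem theorem3p6 (R : realType) (n : nat) (p : R) :
  1 < p -> p <= n%:R ->
  forall C : R, 0 < C ->
  exists (Q : cube R n) (f g : 'rV[R]_n -> R),
    [/\ Lip Q f, morrey p Q g &
      (C%:E * morrey_norm p Q g * gradient_Lp_norm p Q f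
         < Lp_norm p Q (fun x => (g x * (f x - mean Q f))%R))%E].
Proof.
move=> p1 pn C C0; have p0 : 0 < p by lra.
have W0 : 0 < 2 ^+ n :> R by rewrite exprn_gt0.
pose B : R := C * 2 ^+ n * (2 * n%:R * 4 ^+ n) * (2 * 2 ^+ n).
have B0 : 0 <= B by rewrite !mulr_ge0 ?exprn_ge0// ltW.
pose q := 1 - p^-1.
have q0 : 0 < q by rewrite subr_gt0 invf_lt1.
(* The first term makes N ^ q, which is N / N ^ (1 / p), exceed B; the second
   one is the lower bound on N of [norm_weight_potential]. *)
pose z : R := (B + 1) `^ q^-1 + 8 * 4 ^+ n.
have e8 : 1 <= 8 * 4 ^+ n :> R.
  have : 1 <= 4 ^+ n :> R by rewrite exprn_ege1// ler1n.
  by lra.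
have z0 : 0 <= (B + 1) `^ q^-1 by exact: powR_ge0.
have [N zN] : exists N, z < N%:R by exists (Num.truncn z).+1; rewrite truncnS_gt.
have N0 : 0 < N%:R :> R by apply: le_lt_trans zN; rewrite /z; lra.
exists unit_cube, (potential (branching (n := n) p) N), (weight p N); split.
- exact: Lip_potential.
- exact: morrey_weight.
have NM : 8 * 4 ^+ n <= N%:R :> R by rewrite /z in zN; lra.
apply: lt_le_trans (norm_weight_potential p1 pn NM).
apply: (@le_lt_trans _ _ (C%:E * (2 ^+ n)%:E * (2 * n%:R * 4 ^+ n * N%:R `^ p^-1)%:E)%E).
  apply: lee_pmul => //.
  - rewrite mule_ge0 ?lee_fin ?(ltW C0)//.
    apply: le_trans (ereal_sup_ubound _); last by exists unit_cube; [exact: dyadic_refl|].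
    by rewrite mule_ge0 ?poweR_ge0 ?Lnorm_ge0.
  - exact: Lnorm_ge0.
  - by rewrite lee_wpmul2l ?lee_fin ?(ltW C0)//; exact: morrey_norm_weight.
  - exact: gradient_norm_potential.
rewrite -!EFinM lte_fin ltr_pdivlMr ?mulr_gt0//.
have BN : B < N%:R `^ q.
  apply: (@lt_le_trans _ _ (B + 1)); first by rewrite ltrDl.
  have -> : B + 1 = ((B + 1) `^ q^-1) `^ q.
    by rewrite -powRrM mulVf ?gt_eqF// powRr1 ?addr_ge0.
  rewrite ge0_ler_powR ?(ltW q0) ?nnegrE ?powR_ge0// ?(ltW N0)//.
  by rewrite /z in zN; lra.
have pq : p^-1 + q = 1 by rewrite /q addrC subrK.
have NE : N%:R = N%:R `^ p^-1 * N%:R `^ q :> R.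
  by rewrite -powRD ?pq ?powRr1 ?(ltW N0)// oner_eq0.
rewrite [ltRHS]NE [ltLHS](_ : _ = N%:R `^ p^-1 * B); last first.
  by rewrite /B; move: (N%:R `^ _) (2 ^+ n) (4 ^+ n) (n%:R : R) => a b c d; ring.
by rewrite ltr_pM2l// powR_gt0.
Qed.
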